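(* Let $P$ be a $3\times 3$ permutation matrix. Then for every integer $n\ge 3$, $\mathrm{M}(n,P)=n^2-3n+3$.
   Context: All matrices are $(0,1)$-matrices. An $n\times n$ matrix $A$ is strongly $P$-forcing if for every $1$-entry $o$ of $A$ there is a $3\times 3$ submatrix of $A$ (any $3$ rows and any $3$ columns, order kept) exactly equal to $P$ that contains $o$. $\mathrm{M}(n,P)$ is the maximum number of $1$-entries of an $n\times n$ strongly $P$-forcing matrix (defined for $n\ge 3$). *)

(* Defs.v *)
From mathcomp Require Import all_boot all_order all_fingroup all_algebra.
Set Implicit Arguments.
Unset Strict Implicit.
Unset Printing Implicit Defensive.

(* (0,1)-matrices are matrices over bool, whose library ring structure has
   0 = false and 1 = true; thus [is_perm_mx] on them is the usual notion. *)

Definition increasing k n (f : {ffun 'I_k -> 'I_n}) : bool :=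
  [forall a : 'I_k, forall b : 'I_k, (a < b) ==> (f a < f b)].

Definition copy_at k n (P : 'M[bool]_k) (A : 'M[bool]_n)
    (f g : {ffun 'I_k -> 'I_n}) (i j : 'I_n) : bool :=
  [&& increasing f, increasing g, mxsub f g A == P,
      i \in codom f & j \in codom g].

Definition strongly_forcing k n (P : 'M[bool]_k) (A : 'M[bool]_n) : bool :=
  [forall i, forall j,
     A i j ==> [exists f, exists g, copy_at P A f g i j]].

Definition ones n (A : 'M[bool]_n) : nat :=
  #|[set ij : 'I_n * 'I_n | A ij.1 ij.2]|.

(* The maximum is over a nonempty set: the zero matrix is vacuously forcing. *)
Definition maxones k n (P : 'M[bool]_k) : nat :=
  \max_(A : 'M[bool]_n | strongly_forcing P A) ones A.
Arguments maxones {k} n P.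

(* Main.v *)
(** Read the 0-entries as the edges of a bipartite graph between rows and
    columns: a 1-entry in a copy of a permutation matrix is a pair of opposite
    vertices of an induced 6-cycle.  If every row has three 0s there are at
    least [3n] of them.  Otherwise some row has exactly two 0s, in columns [p]
    and [q], and every further column has a 0 in a row that meets [p] but not
    [q] and a 0 in a row that meets [q] but not [p]; charging these on top of
    one 0 per row gives [3n - 3].

    Conversely, every 3x3 permutation matrix has a 1 in a corner.  Put a 1 in
    the same corner of the large matrix, 0s in the rest of its row and column,
    and in the remaining [(n-1)x(n-1)] block 0s exactly on one of the two
    diagonals.  The 3x3 permutation matrix is itself the case [n = 3]. *)
Require Import Defs.
From mathcomp Require Import all_boot all_order all_fingroup all_algebra.
From mathcomp Require Import zify.
Set Implicit Arguments.
Unset Strict Implicit.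
Unset Printing Implicit Defensive.

(** * Counting 0-entries and 1-entries *)

Definition zeros n (A : 'M[bool]_n) : nat := \sum_i \sum_j ~~ A i j.

Lemma onesE n (A : 'M[bool]_n) : ones A = \sum_i \sum_j A i j.
Proof.
rewrite /ones -sum1_card big_mkcond /= pair_bigA /=.
by apply: eq_bigr => -[i j] _; rewrite inE /=; case: (A i j).
Qed.

Lemma ones_zeros n (A : 'M[bool]_n) : ones A + zeros A = n ^ 2.
Proof.
rewrite onesE /zeros -big_split /= (eq_bigr (fun=> n)); last first.
  move=> i _; rewrite -big_split /= (eq_bigr (fun=> 1)) ?sum1_card ?card_ord //.
  by move=> j _; case: (A i j).
by rewrite sum_nat_const card_ord.
Qed.

(** * The lower bound on the number of 0-entries *)

Lemma increasing_inj k n (f : {ffun 'I_k -> 'I_n}) :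
  increasing f -> injective f.
Proof.
move=> /forallP fP a b eq_ab; apply/eqP; rewrite -(inj_eq val_inj) /=.
have := fP a => /forallP/(_ b); have := fP b => /forallP/(_ a).
by rewrite eq_ab ltnn !implybF; case: ltngtP.
Qed.

(** The other two rows [i1], [i2] of the copy have their 1s in its other two columns [j1], [j2]. The
    order of rows and columns is forgotten. *)
Lemma forcing_hexagon n (P : 'M[bool]_3) (A : 'M[bool]_n) i j :
    is_perm_mx P -> strongly_forcing P A -> A i j ->
  exists i1 i2 j1 j2, [/\ j1 != j2, ~~ A i j1, ~~ A i j2 &
    [/\ ~~ A i1 j, A i1 j1 & ~~ A i1 j2]
    /\ [/\ ~~ A i2 j, ~~ A i2 j1 & A i2 j2]].
Proof.
case/is_perm_mxP=> s -> /forallP/(_ i)/forallP/(_ j)/implyP forceA Aij.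
have /existsP[f /existsP[g]] := forceA Aij.
case/and5P=> _ /increasing_inj g_inj /eqP eqA.
case/codomP=> a def_i /codomP[b def_j].
have AE c d : A (f c) (g d) = (s c == d).
  by move/matrixP: eqA => /(_ c d); rewrite !mxE => ->; case: (s c == d).
have {b} {}def_j : j = g (s a).
  by move: Aij; rewrite def_i def_j AE => /eqP->.
have [b [c [ab ac bc]]] : exists b c : 'I_3, [/\ a != b, a != c & b != c].
  (* Addition in ['I_3] is modulo 3. *)
  by exists (a + 1)%R, (a + 1 + 1)%R; case: a {def_i def_j} => -[|[|[]]].
exists (f b), (f c), (g (s b)), (g (s c)).
rewrite def_i def_j !AE (inj_eq g_inj) !(inj_eq perm_inj) !eqxx.
by rewrite (eq_sym b a) (eq_sym c a) (eq_sym c b) ab ac bc.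
Qed.

Lemma zeros_ge n (P : 'M[bool]_3) (A : 'M[bool]_n) :
  is_perm_mx P -> 3 <= n -> strongly_forcing P A -> 3 * n - 3 <= zeros A.
Proof.
move=> permP n_ge3 forceA.
have hex i j := @forcing_hexagon n P A i j permP forceA.
pose z i j : nat := ~~ A i j.
have row_split i p q : p != q ->
    \sum_j z i j = z i p + z i q + \sum_(j | (j != p) && (j != q)) z i j.
  by move=> pq; rewrite (bigD1 p) //= (bigD1 q) 1?eq_sym //= addnA.
have row_ge2 i : 2 <= \sum_j z i j.
  case: (pickP (A i)) => [j Aij|A0].
    have [i1 [i2 [p [q [pq Aip Aiq _]]]]] := hex _ _ Aij.
    by rewrite (row_split _ _ _ pq) /z Aip Aiq.
  rewrite (eq_bigr (fun=> 1)) => [|j _]; last by rewrite /z A0.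
  by rewrite sum1_card card_ord ltnW.
case: (pickP (fun i => \sum_j z i j < 3)) => [i|row_ge3]; last first.
  have : \sum_(i < n) 3 <= zeros A.
    by apply: leq_sum => i _; rewrite leqNgt [_ < 3]row_ge3.
  by rewrite sum_nat_const card_ord; lia.
move=> row_lt3.
have [j0 Aij0] : exists j, A i j.
  case: (pickP (A i)) => [j Aij|A0]; first by exists j.
  move: row_lt3; rewrite (eq_bigr (fun=> 1)) => [|j _]; last by rewrite /z A0.
  by rewrite sum1_card card_ord ltnNge n_ge3.
have [_ [_ [p [q [pq Aip Aiq _]]]]] := hex _ _ Aij0.
have Ai j : ~~ A i j = (j == p) || (j == q).
  case: eqVneq => [->//|jp]; case: eqVneq => [->//|jq] /=.
  apply/negbTE; apply/negP => Aij; move: row_lt3.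
  by rewrite (row_split _ _ _ pq) (bigD1 j) ?jp //= /z Aip Aiq Aij.
pose T x := \sum_(j | (j != p) && (j != q)) z x j.
pose B x := (A x p != A x q).
(* If [B x] holds, exactly one 0 of row [x] lies in columns [p], [q], besides the [T x] others.
   Otherwise the left side is at most 2, and [row_ge2] suffices; row [i] is of this kind. *)
have row_bound x : 1 + (x == i) + B x * T x <= \sum_j z x j.
  have := row_ge2 x; rewrite (row_split _ _ _ pq) -/(T x) /B /z.
  case: (x =P i) => [->|_]; first by rewrite (negbTE Aip) (negbTE Aiq) /=; lia.
  by case: (A x p); case: (A x q) => /=; lia.
(* Here [A i j] is a 1, and the 0s of row [i] in its hexagon can only be [p] and [q]. Hence [i1] and
   [i2] each have one 1 and one 0 there, and both have a 0 in column [j]. *)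
have col_bound j : (j != p) && (j != q) -> 2 <= \sum_x B x * z x j.
  rewrite -negb_or -Ai negbK => /hex[i1 [i2 [j1 [j2 [j12 Ai1 Ai2]]]]].
  case=> -[Z1 U1 V1] [Z2 V2 U2].
  have i12 : i2 != i1 by apply: contraNneq V2 => ->.
  have [B1 B2] : B i1 /\ B i2.
    move: j12 Ai1 Ai2; rewrite !Ai.
    by move=> j12 /orP[]/eqP e1 /orP[]/eqP e2; move: j12 U1 V1 U2 V2;
      rewrite /B e1 e2 ?eqxx // => _ -> /negbTE-> -> /negbTE->.
  by rewrite (bigD1 i1) //= (bigD1 i2) //= B1 B2 /z Z1 Z2.
have : \sum_x (1 + (x == i) + B x * T x) <= zeros A by apply: leq_sum.
rewrite !big_split /= sum1_card card_ord.
have -> : \sum_x (x == i : nat) = 1.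
  by rewrite (bigD1 i) //= eqxx big1 // => x /negbTE->.
(* Double counting: sum over the [n - 2] columns first. The total is then
   [n + 1 + 2 * (n - 2) = 3 * n - 3]. *)
have : (n - 2) * 2 <= \sum_x B x * T x.
  under eq_bigr do rewrite big_distrr /=.
  rewrite exchange_big /=.
  have -> : n - 2 = #|[pred j | (j != p) && (j != q)]|.
    have := cardC (pred2 p q); rewrite card2 pq card_ord => {1}<-.
    by rewrite addKn; apply: eq_card => j; rewrite !inE negb_or.
  by rewrite -sum_nat_const; apply: leq_sum.
move=> sum_ge; apply: leq_trans; apply: leq_trans (leq_add (leqnn _) sum_ge).
by lia.
Qed.

(** * The extremal matrices *)

Definition corner (e : bool) m : 'I_m.+1 := if e then ord_max else ord0.

Definition flip (c : bool) m (i : 'I_m) : 'I_m := if c then rev_ord i else i.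

(** The block has its 0s on the main diagonal, or on the antidiagonal when [c] is true. One family
    covers both the extremal matrix and, at [m = 2], the pattern itself. *)
Definition bordered (e1 e2 c : bool) m : 'M[bool]_m.+1 :=
  (\matrix_(i, j) match unlift (corner e1 m) i, unlift (corner e2 m) j with
    | None, None => true
    | Some i', Some j' => flip c i' != j'
    | _, _ => false
    end)%R.

Lemma flipK c m : involutive (@flip c m).
Proof. by case: c => // i; apply: rev_ordK. Qed.

Lemma flip_lt c m (i j : 'I_m) :
  (flip c i < flip c j) = if c then j < i else i < j.
Proof.
by case: c => //=; have := ltn_ord i; have := ltn_ord j; lia.
Qed.

Lemma ones_bordered e1 e2 c m : ones (bordered e1 e2 c m) = 1 + m * m.-1.
Proof.
rewrite onesE (bigD1_ord (corner e1 m)) //= (bigD1_ord (corner e2 m)) //=.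
rewrite mxE !unlift_none big1 => [|j _]; last by rewrite mxE unlift_none liftK.
rewrite addn0; congr addn; rewrite (eq_bigr (fun=> m.-1)); last first.
  move=> i _; rewrite (bigD1_ord (corner e2 m)) //= mxE liftK unlift_none add0n.
  under eq_bigr do rewrite mxE !liftK.
  rewrite (bigD1 (flip c i)) //= eqxx add0n (eq_bigr (fun=> 1)).
    by rewrite sum1_card cardC1 card_ord.
  by move=> j; rewrite eq_sym => ->.
by rewrite sum_nat_const card_ord.
Qed.

(** * Copies of the pattern through the border *)

Definition extend e k m (h : 'I_k -> 'I_m) : {ffun 'I_k.+1 -> 'I_m.+1} :=
  [ffun a =>
     oapp (lift (corner e m) \o h) (corner e m) (unlift (corner e k) a)].

Lemma extend_corner e k m (h : 'I_k -> 'I_m) :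
  extend e h (corner e k) = corner e m.
Proof. by rewrite ffunE unlift_none. Qed.

Lemma extend_lift e k m (h : 'I_k -> 'I_m) a :
  extend e h (lift (corner e k) a) = lift (corner e m) (h a).
Proof. by rewrite ffunE liftK. Qed.

(** The border index is extreme, on the same side in both sizes, so it compares alike with all
    lifted indices. *)
Lemma extend_increasing e k m (h : 'I_k -> 'I_m) :
  {homo h : a b / a < b} -> increasing (extend e h).
Proof.
move=> h_lt; apply/forallP=> a; apply/forallP=> b; apply/implyP.
case: (unliftP (corner e k) a) => [a'|] ->;
  case: (unliftP (corner e k) b) => [b'|] ->;
  rewrite ?extend_lift ?extend_corner /corner; case: e;
  rewrite ?lift_max ?lift0 /= ?ltnn ?ltnS //.
- exact: h_lt.
- exact: h_lt.
- by rewrite ltnNge ltnW.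
Qed.

(** Conjugating [h] by [flip c] for the columns makes the selected rows and columns meet the
    diagonal of 0s in a diagonal of the same kind; two reversals keep the map increasing. *)
Lemma bordered_copy e1 e2 c k m (h : 'I_k -> 'I_m) :
    {homo h : a b / a < b} ->
  let f := extend e1 h in
  let g := extend e2 (fun b => flip c (h (flip c b))) in
  [/\ increasing f, increasing g &
      mxsub f g (bordered e1 e2 c m) = bordered e1 e2 c k].
Proof.
move=> h_lt f g; split; try apply: extend_increasing => //.
  move=> a b; rewrite flip_lt.
  case: c {f g} => //=; last exact: h_lt.
  by move=> ab; apply: h_lt; rewrite (flip_lt true).
have h_inj : injective h.
  move=> a b ab; apply: val_inj; case: (ltngtP a b) => // /h_lt.
    by rewrite ab ltnn.
  by rewrite ab ltnn.
apply/matrixP=> a b; rewrite !mxE /f /g.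
case: (unliftP (corner e1 k) a) => [a'|] ->;
  case: (unliftP (corner e2 k) b) => [b'|] ->;
  rewrite ?extend_lift ?extend_corner ?liftK ?unlift_none //.
rewrite (inj_eq (inv_inj (@flipK c m))) (inj_eq h_inj).
by rewrite (can2_eq (@flipK c k) (@flipK c k)).
Qed.

Lemma pair_sort m (i j : 'I_m) : i != j ->
  exists2 h : 'I_2 -> 'I_m,
    {homo h : a b / a < b} & exists a b, h a = i /\ h b = j.
Proof.
(* [ord0] goes to the smaller of [i] and [j]. *)
move=> ij; exists (fun a => if (a == ord0) == (i < j) then i else j).
  move=> [[|[|//]] /= ?] [[|[|//]] /= ?] //=.
  by move=> _; case: (ltngtP i j) ij => // /val_inj->; rewrite eqxx.
exists (if i < j then ord0 else ord_max), (if i < j then ord_max else ord0).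
by case: ltnP.
Qed.

(** A 1 of the block at [(i', j')] is off the diagonal of 0s, so the block rows [i'] and [flip c j']
    differ; together with the border row they span a copy through that entry. *)
Lemma bordered_forcing e1 e2 c m :
  1 < m -> strongly_forcing (bordered e1 e2 c 2) (bordered e1 e2 c m).
Proof.
move=> m_gt1; apply/forallP=> i; apply/forallP=> j; apply/implyP.
suff copy (i1 i2 : 'I_m) : i1 != i2 -> exists2 h : 'I_2 -> 'I_m,
    (exists a b, h a = i1 /\ h b = i2) &
    forall i j, i \in codom (extend e1 h) ->
      j \in codom (extend e2 (fun b => flip c (h (flip c b)))) ->
      [exists f, exists g,
         copy_at (bordered e1 e2 c 2) (bordered e1 e2 c m) f g i j].
  rewrite mxE; case: (unliftP (corner e1 m) i) => [i'|] ->;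
    case: (unliftP (corner e2 m) j) => [j'|] -> //.
    rewrite -(inj_eq (inv_inj (@flipK c m))) flipK.
    case/copy=> h [a [b [ha hb]]]; apply.
      by rewrite -ha -(extend_lift e1 h) codom_f.
    rewrite -(flipK c j') -hb -{1}(flipK c b).
    by rewrite -(extend_lift e2 (fun b => flip c (h (flip c b)))) codom_f.
  (* The corner 1 lies in all these copies, so any two block rows serve. *)
  have [|h _ hP _] := copy (Ordinal (ltnW m_gt1)) (Ordinal m_gt1); first by [].
  apply: hP; first by rewrite -(extend_corner e1 h) codom_f.
  by rewrite -(extend_corner e2 (fun b => flip c (h (flip c b)))) codom_f.
case/pair_sort=> h h_lt h_surj; exists h => // {}i {}j fi gj.
have [f_incr g_incr eqP] := bordered_copy e1 e2 c h_lt.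
apply/existsP; exists (extend e1 h); apply/existsP.
exists (extend e2 (fun b => flip c (h (flip c b)))).
by rewrite /copy_at f_incr g_incr eqP eqxx fi gj.
Qed.

Lemma perm3_corner (s : {perm 'I_3}) :
  exists e1 e2, s (corner e1 2) = corner e2 2.
Proof.
have ord3 (i : 'I_3) : i != 1%R -> exists e, i = corner e 2.
  case: i => [[|[|[|//]]] /= ?] // _; [exists false | exists true];
  exact: val_inj.
(* At most one of the two extreme indices is sent to the middle index 1. *)
case: (eqVneq (s (corner false 2)) 1%R) => [s0|/ord3]; last by exists false.
have /ord3 : s (corner true 2) != 1%R by rewrite -s0 (inj_eq perm_inj).
by exists true.
Qed.

Lemma perm3_bordered (P : 'M[bool]_3) :
  is_perm_mx P -> exists e1 e2 c, P = bordered e1 e2 c 2.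
Proof.
case/is_perm_mxP=> s ->; have [e1 [e2 s_corner]] := perm3_corner s.
have s_lift a : {b | s (lift (corner e1 2) a) = lift (corner e2 2) b}.
  have [|b] := @unlift_some _ (corner e2 2) (s (lift (corner e1 2) a)).
    by rewrite -s_corner (inj_eq perm_inj) neq_lift.
  by exists b.
pose t a := sval (s_lift a).
have tP a : s (lift (corner e1 2) a) = lift (corner e2 2) (t a).
  exact: svalP (s_lift a).
have t_inj : injective t.
  by move=> a b ab; have := tP a; rewrite ab -tP => /perm_inj/lift_inj.
(* If [t], the permutation left on two indices, is the identity, the 0s of the block are on the
   antidiagonal, so [c] must be true. *)
exists e1, e2, (t ord0 == ord0); apply/matrixP => i j; rewrite !mxE.
case: (unliftP (corner e1 2) i) => [a|] ->;
  case: (unliftP (corner e2 2) j) => [b|] ->;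
  rewrite ?tP ?s_corner ?(inj_eq (@lift_inj _ _)) ?eqxx //.
- have t01 : t ord0 != t ord_max by rewrite (inj_eq t_inj).
  have ord2 (x : 'I_2) : x = if x == ord0 then ord0 else ord_max.
    by case: x => [[|[|//]] ?]; apply: val_inj.
  move: t01; rewrite (ord2 a) (ord2 b) (ord2 (t ord0)) (ord2 (t ord_max)) /flip.
  case: (a == ord0); case: (b == ord0); case E : (t ord0 == ord0);
  case F : (t ord_max == ord0) => //=; rewrite 1?(ord2 (t _)) ?E ?F //.
- by rewrite eq_sym (negbTE (neq_lift _ _)).
- by rewrite (negbTE (neq_lift _ _)).
Qed.

Theorem theorem3 (P : 'M[bool]_3) (hP : is_perm_mx P) (n : nat) (hn : 3 <= n) :
  maxones n P = n ^ 2 - 3 * n + 3.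
Proof.
apply/eqP; rewrite eqn_leq; apply/andP; split.
  apply/bigmax_leqP => A /(zeros_ge hP hn).
  have := ones_zeros A; nia.
case: n hn => // m m_ge2; have [e1 [e2 [c defP]]] := perm3_bordered hP.
have := leq_bigmax_cond (F := @ones m.+1) _
          (bordered_forcing e1 e2 c m_ge2).
rewrite -defP ones_bordered; apply: leq_trans.
(* With [n = m + 1], [1 + m * (m - 1) = n ^ 2 - 3 * n + 3]. *)
by case: m m_ge2 => [|[|m]] // _; rewrite -mulnn /= !(mulSn, mulnS); lia.
Qed.
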